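(* A nonempty shift space $X$ over a finite alphabet admits a Gibbs state if and only if it is balanced.
   Context: $\mathcal{B}_n(X)$ is the set of words of length $n$ appearing in points of $X$, $\mathcal{B}(X)=\bigcup_n\mathcal{B}_n(X)$, and $h(X)=\lim_{n}\frac1n\log|\mathcal{B}_n(X)|$ with $\log$ to base $2$. For $\omega\in\mathcal{B}(X)$ and $r\in\mathbb{N}$, $\mathcal{B}_{\omega,r}(X)$ is the set of words $u$ of length $r$ with $\omega u\in\mathcal{B}(X)$. $X$ is balanced if there is $B>0$ such that $|\mathcal{B}_{\omega,r}(X)|/|\mathcal{B}_r(X)|\ge B$ for all $\omega\in\mathcal{B}(X)$, $r\in\mathbb{N}$. For a word $\omega$, $[\omega]$ denotes the cylinder set of points of $X$ having $\omega$ at a fixed position. A Borel probability measure $\mu$ on $X$ is a Gibbs state if there exist $c_1,c_2>0$ such that for all $\omega\in\mathcal{B}(X)$ of length $r$, $c_1\le\mu([\omega])\,2^{r h(X)}\le c_2$. *)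

(* Defs.v *)
From HB Require Import structures.
From mathcomp Require Import all_boot all_order all_algebra.
From mathcomp Require Import all_classical all_reals all_analysis.
Set Implicit Arguments. Unset Strict Implicit. Unset Printing Implicit Defensive.
Import Order.TTheory GRing.Theory Num.Theory.
Import numFieldNormedType.Exports.
Local Open Scope classical_set_scope.
Local Open Scope ring_scope.

(* Two-sided full shift over a finite alphabet A; the point a0 is only used
   to equip the configuration space with a pointedType structure, which
   mathcomp-analysis requires for g_sigma_algebraType. *)
Definition config (A : finType) (a0 : A) := int -> A.
HB.instance Definition _ (A : finType) (a0 : A) :=
  gen_eqMixin (config a0).
HB.instance Definition _ (A : finType) (a0 : A) :=
  gen_choiceMixin (config a0).
HB.instance Definition _ (A : finType) (a0 : A) :=
  isPointed.Build (config a0) (fun _ => a0).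

Section Shift.
Variable A : finType.

Definition occurs_at (x : int -> A) (i : int) (w : seq A) : Prop :=
  forall j : nat, (j < size w)%N -> x (i + j%:Z) = nth (x i) w j.

(* X is a shift space: shift invariant (sigma X = X) and closed in the
   product topology (A discrete). *)
Definition shift (x : int -> A) : int -> A := fun i => x (i + 1).

Definition shift_space (X : set (int -> A)) : Prop :=
  (forall x, X x <-> X (shift x)) /\
  (forall x, (forall n : nat, exists y, X y /\
        forall i : int, `|i| <= n%:Z -> y i = x i) -> X x).

Definition lang (X : set (int -> A)) (w : seq A) : Prop :=
  exists x i, X x /\ occurs_at x i w.

Definition blocks (X : set (int -> A)) (n : nat) : {set n.-tuple A} :=
  [set w : n.-tuple A | `[< lang X w >]].

Definition follow (X : set (int -> A)) (om : seq A) (r : nat) : {set r.-tuple A} :=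
  [set u : r.-tuple A | `[< lang X (om ++ u) >]].

Definition entropy {R : realType} (X : set (int -> A)) : R :=
  limn (fun n : nat => (ln (#|blocks X n|%:R : R) / ln (2 : R) / n%:R : R)).

Definition balanced {R : realType} (X : set (int -> A)) : Prop :=
  exists B : R, 0 < B /\
    forall (om : seq A) (r : nat), lang X om ->
      B <= (#|follow X om r|%:R / #|blocks X r|%:R).

Definition cylinder (om : seq A) : set (int -> A) :=
  [set x | occurs_at x 0 om].

(* the cylinder sigma-algebra = Borel sigma-algebra of the product topology *)
Definition cylinders : set (set (int -> A)) :=
  [set C | exists (i : int) (w : seq A), C = [set x | occurs_at x i w]].

End Shift.

Definition borel_config (A : finType) (a0 : A) : set (set (config a0)) :=
  @cylinders A.

(* Borel probability measures on X: probability measures on A^Z (Borel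
   sigma-algebra) giving full mass to the closed set X. *)
Definition gibbs_state {R : realType} (A : finType) (a0 : A)
  (X : set (int -> A)) (mu : probability (g_sigma_algebraType (@borel_config A a0)) R)
  : Prop :=
  mu X = 1%E /\
  exists c1 c2 : R, 0 < c1 /\ 0 < c2 /\
    forall om : seq A, lang X om ->
      (c1%:E <= mu (X `&` cylinder om) * (2 `^ ((size om)%:R * entropy X))%:E)%E /\
      (mu (X `&` cylinder om) * (2 `^ ((size om)%:R * entropy X))%:E <= c2%:E)%E.

(* Main.v *)
(* Write N_r for the number of words of length r and l = 2^h.

   If mu is a Gibbs state, summing mu[w] = sum_u mu[wu] over the words u of
   length r following w compares the number of those u with l^r, and the case
   of the empty word w compares N_r with l^r; the ratio is at least c1^2/c2.

   If X is balanced with constant B, then B N_m N_n <= N_(m+n) <= N_m N_n, so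
   log N_n is additive up to a bounded error and B N_n <= l^n <= N_n / B. Place
   mass 1/N_n at one point of X with prefix u for each word u of length n. For
   r <= n the cylinder of a word w of length r has mass |follow w (n-r)| / N_n,
   between B/N_r and 1/(B N_r). A limit along an ultrafilter is a finitely
   additive set function with the same bounds. It is made countably additive by
   coding: its weights cut [0, 1) into nested intervals indexed by words, and
   the image of Lebesgue measure under the map sending t to the point whose
   prefixes index the intervals containing t is the required Gibbs state. *)
Require Import Defs.
From HB Require Import structures.
From mathcomp Require Import all_boot all_order all_algebra.
From mathcomp Require Import all_classical all_reals all_analysis.
From mathcomp Require Import ring lra zify.
Set Implicit Arguments. Unset Strict Implicit. Unset Printing Implicit Defensive.
Import Order.TTheory GRing.Theory Num.Theory.
Import numFieldNormedType.Exports.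
Local Open Scope classical_set_scope.
Local Open Scope ring_scope.

(** * Words and counting *)

Section Words.
Variable A : finType.
Implicit Types (x : int -> A) (w : seq A) (X : set (int -> A)).

Definition word x (i : int) (n : nat) : seq A :=
  mkseq (fun j : nat => x (i + j%:Z)) n.

Lemma size_word x i n : size (word x i n) = n.
Proof. exact: size_mkseq. Qed.

Lemma occurs_atP x i w : occurs_at x i w <-> word x i (size w) = w.
Proof.
split=> [occ|<-].
  apply: (@eq_from_nth _ (x i)); rewrite size_word // => j jw.
  by rewrite nth_mkseq // occ.
by move=> j; rewrite size_word => jn; rewrite nth_mkseq.
Qed.

Lemma word_cat x i m n : word x i (m + n) = word x i m ++ word x (i + m%:Z) n.
Proof.
rewrite /word /mkseq iotaD map_cat add0n; congr (_ ++ _).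
rewrite -[m in iota m n]addn0 iotaDl -map_comp; apply: eq_map => j /=.
by rewrite -addrA PoszD.
Qed.

Lemma langP X w : lang X w <-> exists x i, X x /\ word x i (size w) = w.
Proof.
by split=> -[x [i [Xx /occurs_atP h]]]; exists x, i; split=> //; apply/occurs_atP.
Qed.

Lemma lang_word X x i n : X x -> lang X (word x i n).
Proof. by move=> Xx; apply/langP; exists x, i; rewrite size_word. Qed.

Lemma lang_catl X u w : lang X (u ++ w) -> lang X u.
Proof.
move=> /langP[x [i [Xx]]]; rewrite size_cat word_cat => /eqP.
rewrite eqseq_cat ?size_word // => /andP[/eqP <- _]; exact: lang_word.
Qed.

Lemma lang_catr X u w : lang X (u ++ w) -> lang X w.
Proof.
move=> /langP[x [i [Xx]]]; rewrite size_cat word_cat => /eqP.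
rewrite eqseq_cat ?size_word // => /andP[_ /eqP <-]; exact: lang_word.
Qed.

(** The equivalence in [shift_space] is used both ways: one implication translates by 1, the other
    by -1, and each is iterated. *)
Lemma shift_space_translate X x (k : int) :
  shift_space X -> X x -> X (fun i => x (i + k)).
Proof.
move=> [shX _] Xx.
have up n y : X y -> X (fun i => y (i + n%:Z)).
  elim: n y => [|n IH] y Xy.
    by rewrite (_ : (fun i => _) = y) //; apply/funext => i; rewrite addr0.
  have /shX := IH _ Xy; congr X; apply/funext => i; rewrite /shift.
  by congr y; lia.
have down n y : X y -> X (fun i => y (i - n%:Z)).
  elim: n y => [|n IH] y Xy.
    by rewrite (_ : (fun i => _) = y) //; apply/funext => i; rewrite subr0.
  apply/shX; have := IH _ Xy; congr X; apply/funext => i; rewrite /shift.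
  by congr y; lia.
case: k => n; first exact: up.
by rewrite NegzE; exact: down.
Qed.

Lemma lang_point X w : shift_space X -> lang X w ->
  exists x, X x /\ word x 0 (size w) = w.
Proof.
move=> sX /langP[x [i [Xx wE]]]; exists (fun j => x (j + i)); split.
  exact: (shift_space_translate i sX Xx).
by rewrite -[RHS]wE; apply: eq_mkseq => j /=; rewrite add0r addrC.
Qed.

Lemma in_followP X w r (u : r.-tuple A) :
  reflect (lang X (w ++ u)) (u \in follow X w r).
Proof. by rewrite inE; exact: asboolP. Qed.

Lemma in_blocksP X r (u : r.-tuple A) : reflect (lang X u) (u \in blocks X r).
Proof. by rewrite inE; exact: asboolP. Qed.

Lemma follow_nil X r : follow X [::] r = blocks X r.
Proof. by apply/setP => u; rewrite !inE. Qed.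

Lemma follow_sub_blocks X w r : follow X w r \subset blocks X r.
Proof.
apply/fintype.subsetP => u /in_followP h; apply/in_blocksP.
exact: lang_catr h.
Qed.

Lemma blocks_gt0 X r : X !=set0 -> (0 < #|blocks X r|)%N.
Proof.
move=> [x Xx]; apply/card_gt0P.
have sz : size (word x 0 r) == r by rewrite size_word.
by exists (Tuple sz); apply/in_blocksP; exact: lang_word.
Qed.

(** Prepending [w] is a bijection between the two sets. This turns the mass that a counting measure
    gives to a cylinder into a number of followers. *)
Lemma card_blocks_prefix X w k :
  #|[set v in blocks X (size w + k) | take (size w) v == w]| = #|follow X w k|.
Proof.
pose f (u : k.-tuple A) : (size w + k).-tuple A := cat_tuple (in_tuple w) u.
have fI : injective f.
  move=> u v /(congr1 val) /= /eqP; rewrite eqseq_cat // eqxx /= => /eqP.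
  exact: val_inj.
rewrite -(card_imset _ fI); apply: eq_card => v; rewrite [LHS]finset.in_set.
apply/andP/imsetP => [[/in_blocksP lv /eqP tv]|[u uf ->]].
  have sz : size (drop (size w) v) == k by rewrite size_drop size_tuple addKn.
  have vE : v = f (Tuple sz).
    by apply: val_inj; rewrite /= -[LHS](cat_take_drop (size w)) tv.
  exists (Tuple sz) => //; apply/in_followP.
  by move: lv; rewrite {1}vE.
by rewrite /= take_size_cat // eqxx; split => //; apply/in_blocksP/in_followP.
Qed.

Lemma card_blocksD X m n :
  #|blocks X (m + n)| = (\sum_(w in blocks X m) #|follow X w n|)%N.
Proof.
have szt (v : (m + n).-tuple A) : size (take m v) == m.
  by rewrite size_takel // size_tuple leq_addr.
pose f v : m.-tuple A := Tuple (szt v).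
rewrite -sum1_card (partition_big f (mem (blocks X m))) /=; last first.
  move=> v /in_blocksP lv; apply/in_blocksP.
  by apply: (@lang_catl _ _ (drop m v)); rewrite cat_take_drop.
apply: eq_bigr => w _; rewrite -card_blocks_prefix sum1_card size_tuple.
by apply: eq_card => v; rewrite [RHS]finset.in_set.
Qed.

End Words.

(** * Almost additive sequences *)

Lemma near_additive_mul (R : realType) (a : nat -> R) (C : R) :
  (forall m n, `|a (m + n)%N - a m - a n| <= C) ->
  forall k n, `|a (k.+1 * n)%N - k.+1%:R * a n| <= k%:R * C.
Proof.
move=> aC k n; elim: k => [|k IH]; first by rewrite mul1n mul1r subrr normr0 mul0r.
have -> : a (k.+2 * n)%N - k.+2%:R * a n =
    (a (n + k.+1 * n)%N - a n - a (k.+1 * n)%N) +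
    (a (k.+1 * n)%N - k.+1%:R * a n).
  by rewrite -mulSn -[k.+2]addn1 natrD; ring.
apply: (le_trans (ler_normD _ _)).
by rewrite -[X in _ <= X%:R * _]addn1 natrD mulrDl mul1r [leRHS]addrC lerD.
Qed.

(** Both [n * a m] and [m * a n] are close to [a (m * n)], by [near_additive_mul]; compare them and
    divide by [m]. *)
Lemma near_additive_ratio (R : realType) (a : nat -> R) (C : R) :
  (forall m n, `|a (m + n)%N - a m - a n| <= C) ->
  forall m n, (0 < m)%N -> (0 < n)%N ->
  `|a n - n%:R * (a m / m%:R)| <= (1 + n%:R / m%:R) * C.
Proof.
move=> aC [//|m] [//|n] _ _.
have C0 : 0 <= C by exact: le_trans (aC 0%N 0%N).
have h1 := near_additive_mul aC m n.+1; have h2 := near_additive_mul aC n m.+1.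
rewrite mulnC in h2.
have m0 : 0 < m.+1%:R :> R by rewrite ltr0n.
rewrite -(ler_pM2l m0) -[X in X * `|_|](gtr0_norm m0) -normrM.
have -> : m.+1%:R * (a n.+1 - n.+1%:R * (a m.+1 / m.+1%:R)) =
  (a (m.+1 * n.+1)%N - n.+1%:R * a m.+1) - (a (m.+1 * n.+1)%N - m.+1%:R * a n.+1).
  by field; rewrite addrC natr1 pnatr_eq0.
have -> : m.+1%:R * ((1 + n.+1%:R / m.+1%:R) * C) = n.+1%:R * C + m.+1%:R * C.
  by field; rewrite addrC natr1 pnatr_eq0.
apply: (le_trans (ler_normB _ _)); apply: lerD.
  by apply: (le_trans h2); rewrite ler_wpM2r // ler_nat.
by apply: (le_trans h1); rewrite ler_wpM2r // ler_nat.
Qed.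

(** Divided by [n], the ratio bound shows that [a n / n] is Cauchy; letting [m] tend to infinity in
    the same bound, with [n] fixed, leaves the error [C]. *)
Lemma near_additive_limn (R : realType) (a : nat -> R) (C : R) :
  (forall m n, `|a (m + n)%N - a m - a n| <= C) ->
  forall n, `|a n - n%:R * limn (fun n => a n / n%:R)| <= C.
Proof.
move=> aC.
have C0 : 0 <= C by exact: le_trans (aC 0%N 0%N).
have ratio := near_additive_ratio aC.
set b := fun n => a n / n%:R.
have bcvg : cvgn b.
  apply/cauchy_cvgP/cauchy_exP => e e0.
  (* For [n > k] the error is at most [2 * C / k.+1], which this choice makes smaller than [e]. *)
  have [k] : exists k : nat, 2 * C / e < k.+1%:R.
    exists (Num.bound (2 * C / e)).
    apply: (lt_trans (archi_boundP _)); last by rewrite ltr_nat.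
    by rewrite divr_ge0 ?mulr_ge0 // ltW.
  rewrite ltr_pdivrMr // => ke.
  exists (b k.+1); exists k.+1 => //= n /= kn.
  have n0 : 0 < n%:R :> R by rewrite ltr0n (leq_trans _ kn).
  have k0 : 0 < k.+1%:R :> R by rewrite ltr0n.
  rewrite /ball /= distrC -(ltr_pM2l n0) -[X in X * `|_|](gtr0_norm n0) -normrM.
  have -> : n%:R * (b n - b k.+1) = a n - n%:R * (a k.+1 / k.+1%:R).
    by rewrite mulrBr mulrCA divff ?mulr1 // gt_eqF.
  apply: (le_lt_trans (ratio _ _ _ _)) => //; first by rewrite (leq_trans _ kn).
  rewrite -(ltr_pM2l k0).
  have -> : k.+1%:R * ((1 + n%:R / k.+1%:R) * C) = (k.+1%:R + n%:R) * C.
    by field; rewrite addrC natr1 pnatr_eq0.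
  have knR : k.+1%:R <= n%:R :> R by rewrite ler_nat.
  apply: (@le_lt_trans _ _ (n%:R * (2 * C))).
    by rewrite mulrA ler_wpM2r // mulr_natr mulr2n lerD2r.
  by rewrite [ltRHS]mulrCA ltr_pM2l.
case=> [|n].
  by have := aC 0%N 0%N; rewrite addn0 subrr add0r normrN mul0r subr0.
pose f m := `|a n.+1 - n.+1%:R * b m.+1|.
pose g m := (1 + n.+1%:R * harmonic m) * C : R.
have fcvg : f @ \oo --> `|a n.+1 - n.+1%:R * limn b|.
  apply: cvg_norm; apply: cvgB; first exact: cvg_cst.
  by apply: cvgM; [exact: cvg_cst | rewrite cvg_shiftS].
have gcvg : g @ \oo --> C.
  have -> : C = (1 + n.+1%:R * 0) * C by rewrite mulr0 addr0 mul1r.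
  apply: cvgMl; apply: cvgD; first exact: cvg_cst.
  by apply: cvgM; [exact: cvg_cst | exact: cvg_harmonic].
apply: (ler_cvg_to fcvg gcvg); near=> m.
exact: ratio.
Unshelve. all: by end_near.
Qed.

(** * From Gibbs states to balance *)

(** Measurability of [S] is part of the conclusion because preimages under the coding map are proved
    measurable through it. *)
Lemma measure_finite_partition d (T : measurableType d) (R : realType)
  (mu : {measure set T -> \bar R}) (I : finType) (P : pred I) (F : I -> set T)
  (S : set T) :
  (forall i, P i -> measurable (F i)) ->
  (forall i j t, F i t -> F j t -> i = j) ->
  (forall t, S t <-> exists2 i, P i & F i t) ->
  measurable S /\ mu S = (\sum_(i | P i) mu (F i))%E.
Proof.
move=> mF dF SE.
have -> : S = \big[setU/set0]_(i <- enum P) F i.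
  apply/seteqP; split=> t; rewrite -bigcup_seq.
    by move=> /SE[i Pi Fi]; exists i => //=; rewrite mem_enum.
  by move=> [i /=]; rewrite mem_enum => Pi Fi; apply/SE; exists i.
have Pr i : i \in enum P -> P i by rewrite mem_enum.
rewrite -[in RHS]big_enum /=.
elim: (enum P) (enum_uniq P) Pr => [|i r IH] /=; first by rewrite !big_nil measure0.
move=> /andP[ir ur] Pr; have [|mr mur] := IH ur.
  by move=> j jr; apply: Pr; rewrite inE jr orbT.
have mi : measurable (F i) by apply/mF/Pr; rewrite inE eqxx.
rewrite !big_cons; split; first exact: measurableU.
rewrite measureU //; first by congr (_ + _); exact: mur.
apply/seteqP; split => // t [Fi].
by rewrite -bigcup_seq => -[j /= jr /(dF _ _ _ Fi) ij]; rewrite ij jr in ir.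
Qed.

Section GibbsBalanced.
Variables (R : realType) (A : finType) (a0 : A) (X : set (int -> A)).
Hypothesis sX : shift_space X.

Local Notation T := (g_sigma_algebraType (@borel_config A a0)).

Lemma measurable_occurs i w : measurable ([set x | occurs_at x i w] : set T).
Proof. by apply: sub_gen_smallest; exists i, w. Qed.

(** Closedness writes [X] as a countable intersection of finite unions of cylinders, one union for
    each window [[-n, n]]; hence [X] is Borel. *)
Lemma shift_spaceE : X = \bigcap_n \bigcup_(w in
    [set w : (n + n).+1.-tuple A | exists2 y, X y & occurs_at y (- n%:Z) w])
  [set x | occurs_at x (- n%:Z) w].
Proof.
apply/seteqP; split=> [x Xx n _|x xX].
  have sz : size (word x (- n%:Z) (n + n).+1) == (n + n).+1 by rewrite size_word.
  have oc : occurs_at x (- n%:Z) (Tuple sz) by apply/occurs_atP; rewrite size_word.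
  by exists (Tuple sz) => //; exists x.
apply: sX.2 => n; have [w /= [y Xy yw] xw] := xX n I.
exists y; split=> // i iN.
have -> : i = - n%:Z + (absz (i + n%:Z)%R)%:Z by lia.
have iw : (absz (i + n%:Z)%R < size w)%N by rewrite size_tuple; lia.
by rewrite yw // xw //; exact: set_nth_default.
Qed.

Lemma measurable_shift_space : measurable (X : set T).
Proof.
rewrite shift_spaceE; apply: bigcapT_measurable => n.
apply: fin_bigcup_measurable; first exact: finite_finset.
by move=> w _; exact: measurable_occurs.
Qed.

Lemma measure_follow (mu : {measure set T -> \bar R}) (w : seq A) r :
  mu (X `&` cylinder w) = (\sum_(u in follow X w r) mu (X `&` cylinder (w ++ u)))%E.
Proof.
apply: (measure_finite_partition _ _ _ _).2 => [u _|u v x|x].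
- apply: measurableI; first exact: measurable_shift_space.
  exact: measurable_occurs.
- move=> [_ /occurs_atP xu] [_ /occurs_atP xv]; apply: val_inj => /=.
  move: xu; rewrite !size_cat !size_tuple in xv *; rewrite xv => /eqP.
  by rewrite eqseq_cat // eqxx => /eqP.
- split=> [[Xx /occurs_atP xw]|[u _ [Xx /occurs_atP xu]]].
    have sz : size (word x (0 + (size w)%:Z) r) == r by rewrite size_word.
    have e : word x 0 (size w + r) = w ++ Tuple sz by rewrite word_cat xw.
    exists (Tuple sz).
      by apply/in_followP; rewrite -e; exact: lang_word.
    by split=> //; apply/occurs_atP; rewrite size_cat size_tuple.
  split=> //; apply/occurs_atP; move: xu; rewrite size_cat word_cat => /eqP.
  by rewrite eqseq_cat ?size_word // => /andP[/eqP].
Qed.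

Lemma gibbs_balanced (mu : probability T R) : X !=set0 ->
  gibbs_state X mu -> balanced (R := R) X.
Proof.
move=> X0 [muX [c1 [c2 [c1p [c2p gibbs]]]]].
pose p w := fine (mu (X `&` cylinder w)).
have pE w : mu (X `&` cylinder w) = (p w)%:E.
  rewrite fineK // fin_num_measure //; apply: measurableI.
    exact: measurable_shift_space.
  exact: measurable_occurs.
pose lam n : R := 2 `^ (n%:R * entropy X).
have lam0 n : 0 < lam n by exact: powR_gt0.
have lamD m n : lam (m + n)%N = lam m * lam n.
  by rewrite /lam natrD mulrDl powRD // pnatr_eq0 implybT.
have gib w : lang X w -> c1 <= p w * lam (size w) <= c2.
  by move=> /gibbs; rewrite pE -EFinM !lee_fin => -[-> ->].
have padd w r : p w = \sum_(u in follow X w r) p (w ++ u).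
  apply/EFin_inj; rewrite -pE (measure_follow mu w r) -sumEFin.
  by apply: eq_bigr => u _; exact: pE.
have p_nil : p [::] = 1.
  apply/EFin_inj; rewrite -pE -muX; congr (mu _).
  by apply/seteqP; split => [x [] //|x Xx]; split.
(* The constant combines [hN] and [hF] below: [c1 * N_r <= lam r] and
   [c1 * lam r <= c2 * |follow X w r|]. *)
exists (c1 * c1 / c2); split; first by rewrite divr_gt0 ?mulr_gt0.
move=> w r lw.
have N0 : 0 < #|blocks X r|%:R :> R by rewrite ltr0n blocks_gt0.
have hN : c1 * #|blocks X r|%:R <= lam r.
  have := padd [::] r; rewrite p_nil follow_nil => e.
  have -> : lam r = \sum_(u in blocks X r) p u * lam r.
    by rewrite -mulr_suml -e mul1r.
  rewrite mulr_natr -sumr_const.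
  apply: ler_sum => u /in_blocksP /gib /andP[+ _]; by rewrite size_tuple.
have hF : c1 * lam r <= #|follow X w r|%:R * c2.
  have /andP[h _] := gib _ lw.
  apply: (@le_trans _ _ (p w * lam (size w) * lam r)).
    by rewrite ler_wpM2r // ltW.
  rewrite -mulrA -lamD (padd w r) mulr_suml mulr_natl -sumr_const.
  apply: ler_sum => u /in_followP /gib /andP[_]; by rewrite size_cat size_tuple.
rewrite ler_pdivlMr // mulrAC ler_pdivrMr //; apply: le_trans hF.
by rewrite -mulrA ler_wpM2l // ltW.
Qed.

End GibbsBalanced.

(** * Coding by nested intervals *)

Section IntervalCoding.
Variables (R : realType) (A : finType) (a0 : A) (q : seq A -> R).
Hypotheses (q_ge0 : forall w, 0 <= q w) (q_nil : q [::] = 1)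
  (q_cons : forall w, q w = \sum_a q (a :: w)).

(* Prefixes are reversed so that extending a prefix is [cons]. *)
Fixpoint revprefix (x : nat -> A) n : seq A :=
  if n is m.+1 then x m :: revprefix x m else [::].

Lemma size_revprefix x n : size (revprefix x n) = n.
Proof. by elim: n => //= n ->. Qed.

Lemma eq_revprefix x y n :
  revprefix x n = revprefix y n <-> forall j, (j < n)%N -> x j = y j.
Proof.
elim: n => [|n IH] //=; split=> [[xyn /IH xy] j|xy].
  by rewrite ltnS leq_eqVlt => /predU1P[->//|/xy].
by rewrite xy // (IH.2 _) // => j jn; rewrite xy // ltnW.
Qed.

(** The intervals of the words [b :: w'] are laid side by side in the order of [enum A], from the
    left end of the interval of [w']; by [q_cons] they tile it. *)
Fixpoint left_end (w : seq A) : R :=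
  if w is a :: w' then
    left_end w' + \sum_(b <- take (index a (enum A)) (enum A)) q (b :: w')
  else 0.

(** Half-open intervals make the tiling exact, and a word of weight 0 gets the empty interval. *)
Definition code_itv w : set R := `[left_end w, left_end w + q w[%classic.

Lemma locate_sum (r : seq A) (f : A -> R) t : uniq r ->
  0 <= t -> t < \sum_(b <- r) f b ->
  exists a, \sum_(b <- take (index a r) r) f b <= t
            < \sum_(b <- take (index a r) r) f b + f a.
Proof.
elim: r t => [|c r IH] t /=.
  by rewrite big_nil => _ /le_lt_trans h /h; rewrite ltxx.
move=> /andP[cr ur] t0; rewrite big_cons => tlt.
have [tc|ct] := ltP t (f c).
  by exists c; rewrite eqxx /= big_nil add0r t0.
have [||a /andP[at1 at2]] := IH (t - f c) ur; rewrite ?subr_ge0 ?ltrBlDl //.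
case: (eqVneq c a) => [ca|ca].
  (* The letter found for the tail need not lie in the tail. If it is [c], its index there is the
     length of the tail, so the whole sum is at most [t], a contradiction. *)
  move: at1 at2; rewrite -ca memNindex // take_size -ltrBrDl => h1 h2.
  by move: (lt_le_trans tlt (lerD (lexx _) h1)); rewrite addrC subrK ltxx.
by exists a; rewrite (negPf ca) /= big_cons -lerBrDl at1 -addrA -ltrBlDl.
Qed.

Lemma sum_take_index (r : seq A) (f : A -> R) a b : (forall c, 0 <= f c) ->
  a \in r -> (index a r < index b r)%N ->
  \sum_(c <- take (index a r) r) f c + f a <= \sum_(c <- take (index b r) r) f c.
Proof.
move=> f0; elim: r => [|c r IH] //=; rewrite inE [c == a]eq_sym.
case: (eqVneq a c) => [<-|ac] /=.
  move=> _; case: ifP => //= _ _.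
  by rewrite big_nil add0r big_cons lerDl sumr_ge0.
by move=> ar; case: ifP => //= _ h; rewrite !big_cons -addrA lerD2l IH.
Qed.

Lemma sum_take_le (r : seq A) (f : A -> R) a : (forall c, 0 <= f c) ->
  a \in r -> \sum_(c <- take (index a r) r) f c + f a <= \sum_(c <- r) f c.
Proof.
move=> f0; elim: r => [|c r IH] //=; rewrite inE [c == a]eq_sym.
case: (eqVneq a c) => [<-|ac] /= ar.
  by rewrite big_nil add0r big_cons lerDl sumr_ge0.
by rewrite !big_cons -addrA lerD2l IH.
Qed.

Lemma code_itv_child w t : code_itv w t -> exists a, code_itv (a :: w) t.
Proof.
rewrite /code_itv /= in_itv /= => /andP[wt tw].
have [||a /andP[h1 h2]] := @locate_sum _ (fun b => q (b :: w)) (t - left_end w)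
  (enum_uniq A).
- by rewrite subr_ge0.
- by rewrite ltrBlDl big_enum /= -q_cons.
by exists a; rewrite in_itv /= -lerBrDl h1 -addrA -ltrBlDl.
Qed.

Lemma code_itv_parent a w : code_itv (a :: w) `<=` code_itv w.
Proof.
move=> t; rewrite /code_itv /= !in_itv /= => /andP[h1 h2]; apply/andP; split.
  by apply: le_trans h1; rewrite lerDl sumr_ge0.
apply: (lt_le_trans h2); rewrite -addrA lerD2l [leRHS]q_cons -big_enum /=.
exact: (@sum_take_le _ (fun b => q (b :: w))) (mem_enum _ _).
Qed.

Lemma code_itv_sibling a b w t :
  code_itv (a :: w) t -> code_itv (b :: w) t -> a = b.
Proof.
wlog ab : a b / (index a (enum A) <= index b (enum A))%N.
  by move=> H h1 h2; case/orP: (leq_total (index a (enum A)) (index b (enum A)))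
    => /H h; [exact: h | apply/esym/h].
move: ab; rewrite leq_eqVlt => /orP[/eqP e _ _|ab].
  by rewrite -(nth_index a (mem_enum A a)) e nth_index // mem_enum.
rewrite /code_itv /= !in_itv /= => /andP[_ h1] /andP[h2 _].
have := le_lt_trans h2 h1; rewrite -addrA ltrD2l => /lt_le_trans.
move/(_ _ (@sum_take_index _ (fun b => q (b :: w)) _ _ (fun=> q_ge0 _)
  (mem_enum _ _) ab)); by rewrite ltxx.
Qed.

Lemma code_itv_sub w : code_itv w `<=` `[0, 1[.
Proof.
elim: w => [|a w IH]; first by rewrite /code_itv /= q_nil add0r.
by move=> t /code_itv_parent /IH.
Qed.

(** A point of an interval lies in one of its children, so choosing children repeatedly from [[::]]
    codes each point of [0, 1). Disjointness of siblings shows that no other words contain the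
    point. *)
Lemma interval_coding : exists phi : R -> nat -> A,
  (forall t n, t \in `[0, 1[ -> code_itv (revprefix (phi t) n) t) /\
  (forall w t, code_itv w t -> revprefix (phi t) (size w) = w).
Proof.
have /choice[nxt nxtP] : forall tw : R * seq A, exists a,
    code_itv tw.2 tw.1 -> code_itv (a :: tw.2) tw.1.
  move=> [t w] /=; have [/code_itv_child[a ha]|h] := pselect (code_itv w t).
    by exists a.
  (* Default letter when [t] is not in the interval of [w]. *)
  by exists a0.
pose fix path (t : R) n := if n is m.+1 then nxt (t, path t m) :: path t m else [::].
pose phi t n := nxt (t, path t n).
have pathE t n : revprefix (phi t) n = path t n by elim: n => //= n ->.
exists phi.
have P1 t n : t \in `[0, 1[ -> code_itv (revprefix (phi t) n) t.
  move=> t01; rewrite pathE; elim: n => [|n IH] /=.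
    by rewrite /code_itv /= q_nil add0r.
  exact: (nxtP (t, path t n)).
split=> // w t; elim: w => [//|a w IH] h /=.
have t01 := code_itv_sub h.
have wE := IH (code_itv_parent h); rewrite wE; congr (_ :: _).
have := P1 t (size w).+1 t01; rewrite /= wE => h'.
exact: code_itv_sibling h' h.
Qed.

End IntervalCoding.

(** * Image of Lebesgue measure under the coding *)

Lemma image_probability d (T : measurableType d) (R : realType) (f : measurableTypeR R -> T) :
  measurable_fun setT f ->
  exists mu : probability T R,
    forall S, mu S = lebesgue_measure (f @^-1` S `&` `[0, 1[).
Proof.
move=> mf.
pose nu := mrestr (@lebesgue_measure R) (measurable_itv `[0, 1[).
have nuT : nu setT = 1%E.
  by rewrite /nu /mrestr setTI lebesgue_measure_itv /= lte_fin ltr01 oppr0 adde0.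
(* The mass of [nu] is already 1; normalising only supplies the structure of a probability. *)
pose P : probability _ R := mnormalize nu point.
exists (distribution P (mfun_Sub (mem_set mf))) => S.
rewrite /distribution /pushforward /P /= /mnormalize /= -/nu.
rewrite nuT /=.
by rewrite onee_eq0 /= invr1 mule1.
Qed.

Section CodingMeasure.
Variables (R : realType) (A : finType) (a0 : A).
Local Notation T := (g_sigma_algebraType (@borel_config A a0)).

(* Enumeration 0, -1, 1, -2, 2, ... of the coordinates, along which
   two-sided configurations are read as one-sided sequences. *)
Definition nat_of_int (k : int) : nat :=
  match k with Posz j => j.*2 | Negz j => j.*2.+1 end.

Definition int_of_nat (j : nat) : int :=
  if odd j then Negz j./2 else Posz j./2.

Lemma nat_of_intK : cancel nat_of_int int_of_nat.
Proof.
case=> j; rewrite /int_of_nat /=; first by rewrite odd_double doubleK.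
by rewrite odd_double /= uphalf_double.
Qed.

Lemma int_of_natK : cancel int_of_nat nat_of_int.
Proof.
move=> j; rewrite /int_of_nat -[RHS]odd_double_half; case: (odd j) => //=.
Qed.

Lemma nat_of_int_le (k : int) : (nat_of_int k <= (absz k).*2)%N.
Proof. by case: k => j /=; rewrite ?doubleS //. Qed.

Definition code_prefix (x : int -> A) n := revprefix (fun j => x (int_of_nat j)) n.

Lemma eq_code_prefix (x y : int -> A) n k :
  code_prefix x n = code_prefix y n -> ((absz k).*2 < n)%N -> x k = y k.
Proof.
move=> /eq_revprefix e kn; have := e (nat_of_int k); rewrite nat_of_intK; apply.
exact: leq_ltn_trans (nat_of_int_le k) kn.
Qed.

(** Membership in a cylinder is decided by a finite prefix, so its preimage under the coding will be
    a finite union of intervals. *)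
Lemma occurs_at_code_prefix (i : int) (w : seq A) : exists n, forall x y,
  code_prefix x n = code_prefix y n -> occurs_at x i w -> occurs_at y i w.
Proof.
(* All coordinates involved have absolute value at most [absz i + size w]. *)
exists (absz i + size w).*2.+1 => x y e oc j jw.
rewrite -(eq_code_prefix e); last by rewrite ltnS leq_double; lia.
by rewrite oc //; exact: set_nth_default.
Qed.

(* The witness is the image of Lebesgue measure on [0, 1) under the interval
   coding of the weights of [m]. No compactness argument is needed: a coded
   point lies in no interval of length 0, so each of its prefixes has positive
   weight, hence occurs in [X], and the point itself is in [X]. *)
Lemma coding_probability (m : set (int -> A) -> R) (X : set (int -> A)) :
  shift_space X -> X !=set0 ->
  (forall S, 0 <= m S) -> m setT = 1 ->
  (forall (F : finType) (f : (int -> A) -> F) S,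
     m S = \sum_v m (S `&` [set x | f x = v])) ->
  (forall S, X `&` S = set0 -> m S = 0) ->
  exists mu : probability T R, mu X = 1%E /\
    forall i w, mu (X `&` [set x | occurs_at x i w]) =
                (m [set x | occurs_at x i w])%:E.
Proof.
move=> sX [x0 Xx0] m_ge0 mT m_add mX.
pose q w := m [set x | code_prefix x (size w) = w].
have m0 : m set0 = 0 by apply: mX; rewrite setI0.
have q_ge0 w : 0 <= q w by exact: m_ge0.
have q_nil : q [::] = 1.
  by rewrite -mT; congr m; apply/seteqP; split.
have q_cons w : q w = \sum_a q (a :: w).
  (* Additivity of [m] over the value of the next coordinate in the enumeration. *)
  rewrite /q (m_add _ (fun x => x (int_of_nat (size w)))).
  apply: eq_bigr => a _; congr m; apply/seteqP; split=> x /=.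
    by rewrite /code_prefix /= => -[-> ->].
  by rewrite /code_prefix /= => -[-> ->].
have [phi [phi_itv itv_phi]] := interval_coding a0 q_ge0 q_nil q_cons.
(* Outside [0, 1), which the image measure ignores, [psi] is constant. *)
pose psi (t : R) : T :=
  if t \in `[0, 1[ then (fun k => phi t (nat_of_int k)) else x0.
have psiE t n : t \in `[0, 1[ -> exists2 y, X y &
    code_prefix y n = revprefix (phi t) n.
  move=> t01; have := phi_itv t n t01; set w := revprefix _ _ => tw.
  have q0 : q w != 0.
    apply/eqP => q0; move: tw; rewrite /code_itv /= in_itv /= q0 addr0.
    by case/andP=> /le_lt_trans h /h; rewrite ltxx.
  have : X `&` [set x | code_prefix x (size w) = w] !=set0.
    by apply/set0P/eqP => /mX h; rewrite /q h eqxx in q0.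
  move=> [y [Xy]]; rewrite /= {1}/w size_revprefix => yw.
  by exists y.
have psi_prefix t n : t \in `[0, 1[ ->
    code_prefix (psi t) n = revprefix (phi t) n.
  by move=> t01; apply/eq_revprefix => j _; rewrite /psi t01 int_of_natK.
have psiX t : t \in `[0, 1[ -> X (psi t).
  move=> t01; apply: sX.2 => n; have [y Xy yE] := psiE t n.*2.+1 t01.
  exists y; split=> // i iN; rewrite -(psi_prefix t) // in yE.
  by apply: (eq_code_prefix yE); rewrite ltnS leq_double; lia.
have preim i w (S := [set x | occurs_at x i w]) :
    measurable (psi @^-1` S `&` `[0, 1[) /\
    lebesgue_measure (psi @^-1` S `&` `[0, 1[) = (m S)%:E.
  have [n nP] := occurs_at_code_prefix i w.
  (* The prefixes of length [n] of points of [S]. Their intervals partition the preimage of [S], and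
     their weights add up to [m S]. *)
  pose good (v : n.-tuple A) := `[< exists2 x, S x & code_prefix x n = v >].
  have [|||mS ->] := @measure_finite_partition _ _ R (@lebesgue_measure R) _ good
    (fun v => code_itv q v) (psi @^-1` S `&` `[0, 1[).
  - by move=> v _; exact: measurable_itv.
  - move=> u v t /itv_phi ut /itv_phi vt; apply: val_inj => /=.
    by rewrite -[LHS]ut -[RHS]vt !size_tuple.
  - move=> t; split=> [[St t01]|[v /asboolP[x Sx xv] tv]].
      have sz : size (revprefix (phi t) n) == n by rewrite size_revprefix.
      exists (Tuple sz); last exact: phi_itv.
      by apply/asboolP; exists (psi t) => //; exact: psi_prefix.
    have t01 := code_itv_sub q_ge0 q_nil q_cons tv; split=> //.
    apply: (nP _ _ _ Sx); rewrite psi_prefix // xv.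
    by rewrite -[LHS](itv_phi _ _ tv) size_tuple.
  split=> //.
  have szp x : size (code_prefix x n) == n by rewrite size_revprefix.
  rewrite (m_add _ (fun x => Tuple (szp x)) S) -sumEFin [LHS]big_mkcond /=.
  apply: eq_bigr => v _; case: ifPn => [/asboolP[x Sx xv]|/asboolPn ngood].
    rewrite lebesgue_measure_itv /= lte_fin ltrDl.
    have -> : m (S `&` [set y | Tuple (szp y) = v]) = q v.
      rewrite /q size_tuple; congr m; apply/seteqP; split=> y /=.
        by move=> [_ /(congr1 val)].
      move=> yv; split; last exact: val_inj.
      by apply: (nP _ _ _ Sx); rewrite xv yv.
    (* The length formula distinguishes nonempty intervals; in the other case the weight is 0 as
       well. *)
    case: ltP => [_|q0]; first by rewrite -EFinB addrAC subrr add0r.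
    by congr EFin; apply/eqP; rewrite eq_le q_ge0 q0.
  rewrite (_ : _ `&` _ = set0) ?m0 //; apply/seteqP; split=> // y [Sy /= yv].
  by apply: ngood; exists y => //; rewrite -yv.
have mpsi : measurable_fun setT (psi : measurableTypeR R -> T).
  (* It suffices to treat the generating cylinders, separating the parts of the preimage inside and
     outside [0, 1). *)
  apply: (@measurability _ _ (measurableTypeR R) T setT psi (@borel_config A a0)) => //.
  move=> _ [_ [i [w ->]] <-]; rewrite setTI.
  set S := [set x | _].
  have -> : psi @^-1` S = (psi @^-1` S `&` `[0, 1[) `|`
      (~` `[0, 1[%classic `&` [set _ | S x0]).
    apply/seteqP; split=> t /=.
      move=> St; have [t01|t01] := boolP (t \in `[0, 1[); [by left | right].
      by split; [exact/negP | move: St; rewrite /psi (negPf t01)].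
    by move=> [[]//|[/negP t01 Sx0]]; rewrite /psi (negPf t01).
  apply: measurableU; first exact: (preim i w).1.
  apply: measurableI; first by apply: measurableC; exact: measurable_itv.
  have [Sx0|Sx0] := pselect (S x0).
    by rewrite (_ : [set _ | _] = setT) //; apply/seteqP; split.
  by rewrite (_ : [set _ | _] = set0) //; apply/seteqP; split.
have [mu muE] := image_probability mpsi.
(* Intersecting with [X] costs nothing, since [psi] maps [0, 1) into [X]. *)
have muX S : mu (X `&` S) = mu S.
  rewrite !muE; congr (lebesgue_measure _); apply/seteqP; split=> t [].
    by move=> [_ St] t01; split.
  by move=> St t01; split=> //; split=> //; exact: psiX.
exists mu; split; last by move=> i w; rewrite muX muE (preim i w).2.
by rewrite -[X in mu X]setIT muX probability_setT.
Qed.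

End CodingMeasure.

(** * From balance to Gibbs states *)

(** Compactness gives a cluster point, and an ultrafilter converges to it: otherwise it would
    contain the complement of a neighbourhood of that point. *)
Lemma cvg_ultra_segment (R : realType) (T : Type) (U : set_system T)
  (a b : R) (f : T -> R) : UltraFilter U ->
  (forall x, f x \in `[a, b]) -> exists l : R, f x @[x --> U] --> l.
Proof.
move=> UU fab.
have PU : ProperFilter U by exact: ultra_proper.
have [|l [_ cl]] := @segment_compact R a b (f @ U) _.
  by apply: (@filterE _ U) => x; exact: fab.
exists l => N Nl; have [//|UN] := in_ultra_setVsetC (f @^-1` N) UU.
by have [y [/= nNy Ny]] := cl (~` N) N UN Nl.
Qed.

(** One ultrafilter refining [\oo] gives limits for all sets at once, so finite sums and eventual
    bounds pass to the limit. Partitions are presented as the fibres of a map to a finite type. *)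
Lemma ultra_mean (R : realType) (T : Type) (nu : nat -> set T -> R) :
  (forall n S, 0 <= nu n S <= 1) ->
  (forall n (F : finType) (f : T -> F) S,
     nu n S = \sum_v nu n (S `&` [set x | f x = v])) ->
  exists m : set T -> R,
    [/\ forall S, 0 <= m S,
        forall (F : finType) (f : T -> F) S,
          m S = \sum_v m (S `&` [set x | f x = v]),
        forall S c, (\forall n \near \oo, c <= nu n S) -> c <= m S &
        forall S c, (\forall n \near \oo, nu n S <= c) -> m S <= c].
Proof.
move=> nu01 nu_add.
have [U [UU ooU]] := @ultraFilterLemma nat \oo _.
have PU : ProperFilter U by exact: ultra_proper.
have /choice[m mP] : forall S, exists l : R, nu n S @[n --> U] --> l.
  by move=> S; apply: cvg_ultra_segment => n; rewrite in_itv /=; exact: nu01.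
exists m; split.
- move=> S; rewrite -(cvg_lim _ (mP S)) //.
  by apply: limr_ge; [exact/cvgP/mP | apply: filterE => n; case/andP: (nu01 n S)].
- move=> F f S; apply: (cvg_unique _ (mP S)) => //.
  have -> : (fun n => nu n S) = (fun n => \sum_v nu n (S `&` [set x | f x = v])).
    by apply/funext => n; exact: nu_add.
  apply: cvg_big => [|v _]; last exact: mP.
  by move=> x; exact: add_continuous.
- move=> S c h; rewrite -(cvg_lim _ (mP S)) //.
  by apply: limr_ge; [exact/cvgP/mP | exact: ooU].
- move=> S c h; rewrite -(cvg_lim _ (mP S)) //.
  by apply: limr_le; [exact/cvgP/mP | exact: ooU].
Qed.

(** * Word counts, entropy and the limiting mean of a balanced shift *)

Section BalancedGibbs.
Variables (R : realType) (A : finType) (a0 : A) (X : set (int -> A)).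
Hypotheses (sX : shift_space X) (X0 : X !=set0).
Local Notation N n := (#|blocks X n|%:R : R).

Let N_gt0 n : 0 < N n.
Proof. by rewrite ltr0n blocks_gt0. Qed.

Lemma card_blocks_submul m n : N (m + n) <= N m * N n.
Proof.
rewrite -natrM ler_nat card_blocksD -sum_nat_const; apply: leq_sum => w _.
exact/subset_leq_card/follow_sub_blocks.
Qed.

Variable B : R.
Hypotheses (B_gt0 : 0 < B)
  (B_le : forall w r, lang X w -> B <= #|follow X w r|%:R / N r).

Let follow_ge w r : lang X w -> B * N r <= #|follow X w r|%:R.
Proof. by move=> /(B_le r); rewrite ler_pdivlMr. Qed.

Lemma card_blocks_supmul m n : B * (N m * N n) <= N (m + n).
Proof.
rewrite card_blocksD natr_sum mulrCA mulr_natl -sumr_const.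
by apply: ler_sum => w /in_blocksP /follow_ge.
Qed.

(** The base-2 logarithm of [N n] is additive up to an error [C], and its limiting slope is the
    entropy; exponentiate the bound of [near_additive_limn]. *)
Lemma balanced_entropy n :
  B * N n <= 2 `^ (n%:R * entropy X) /\ B * 2 `^ (n%:R * entropy X) <= N n.
Proof.
(* [C] is minus the base-2 logarithm of [B], from [B * (N i * N j) <= N (i + j) <= N i * N j]. *)
pose a n : R := ln (N n) / ln 2; pose C : R := - (ln B / ln 2).
have ln2 : 0 < ln 2 :> R by rewrite ln_gt0 // ltr1n.
have aC i j : `|a (i + j)%N - a i - a j| <= C.
  rewrite /a /C -!mulrBl -mulNr normrM (gtr0_norm (x := (ln 2)^-1)) ?invr_gt0 //.
  rewrite ler_pM2r ?invr_gt0 // -addrA -opprD -lnM ?posrE //.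
  have lnle := card_blocks_submul i j; have lnge := card_blocks_supmul i j.
  rewrite -ler_ln ?posrE ?mulr_gt0 // in lnle.
  rewrite -ler_ln ?posrE ?mulr_gt0 // lnM ?posrE ?mulr_gt0 // in lnge.
  by rewrite ler_norml; apply/andP; split; lra.
have := near_additive_limn aC n.
rewrite -[limn _]/(entropy X) ler_norml /C => /andP[h1 h2].
have pow2 x : ln (2 `^ x : R) = x * ln 2 by exact: ln_powR.
have aE : ln (N n) = a n * ln 2 by rewrite /a divfK // gt_eqF.
have BE : ln B = ln B / ln 2 * ln 2 by rewrite divfK // gt_eqF.
split; rewrite -ler_ln ?posrE ?mulr_gt0 ?powR_gt0 //.
  rewrite lnM ?posrE // pow2 aE BE -mulrDl ler_pM2r //.
  by lra.
rewrite lnM ?posrE ?powR_gt0 // pow2 aE BE -mulrDl ler_pM2r //.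
by lra.
Qed.

Lemma balanced_mean : exists m : set (int -> A) -> R,
  [/\ forall S, 0 <= m S, m setT = 1,
      forall (F : finType) (f : (int -> A) -> F) S,
        m S = \sum_v m (S `&` [set x | f x = v]),
      forall S, X `&` S = set0 -> m S = 0 &
      forall w, lang X w ->
        B <= m (cylinder w) * N (size w) /\ B * (m (cylinder w) * N (size w)) <= 1].
Proof.
have /choice[pt ptP] : forall w : seq A, exists x,
    lang X w -> X x /\ word x 0 (size w) = w.
  move=> w; have [/(lang_point sX)[x xP]|nl] := pselect (lang X w).
    by exists x.
  (* Words outside the language get a dummy point; [cnt] sums over blocks only. *)
  by exists (fun=> a0).
pose cnt n (S : set (int -> A)) : R := \sum_(u in blocks X n) (`[< S (pt u) >])%:R.
pose nu n S := cnt n S / N n.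
have cntT n : cnt n setT = N n.
  rewrite /cnt (eq_bigr (fun=> 1)) ?sumr_const // => u _.
  by rewrite asboolT.
have cnt_ge0 n S : 0 <= cnt n S by rewrite sumr_ge0.
have nu01 n S : 0 <= nu n S <= 1.
  rewrite divr_ge0 //= ler_pdivrMr // mul1r -cntT ler_sum // => u _.
  by rewrite ler_nat (asboolT (Logic.I : [set: int -> A] (pt u))) leq_b1.
have nu_add n (F : finType) (f : (int -> A) -> F) S :
    nu n S = \sum_v nu n (S `&` [set x | f x = v]).
  rewrite -mulr_suml exchange_big /=; congr (_ / _); apply: eq_bigr => u _.
  rewrite (bigD1 (f (pt u))) //= big1 ?addr0 => [|v vu].
    by congr (_%:R); congr nat_of_bool; apply/asbool_equiv_eq; split=> [|[]].
  by rewrite asboolF // => -[_ /= e]; rewrite e eqxx in vu.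
have [m [m_ge0 m_add m_ge m_le]] := ultra_mean nu01 nu_add.
have m_eq S c : (forall n, nu n S = c) -> m S = c.
  move=> h; apply/eqP; rewrite eq_le.
  by rewrite m_le ?m_ge //; apply: nearW => n; rewrite h.
exists m; split=> //.
- by apply: m_eq => n; rewrite /nu cntT divff // gt_eqF.
- move=> S XS; apply: m_eq => n; rewrite /nu /cnt big1 ?mul0r // => u.
  move=> /in_blocksP /ptP[Xu _]; rewrite asboolF // => Su.
  by have : (X `&` S) (pt u) by []; rewrite XS.
move=> w lw.
(* For a block [u], the point [pt u] lies in the cylinder of [w] exactly when [u] begins with [w].
   Only large lengths matter for the limit, so [n] is written [size w + k]. *)
have nuE k : nu (size w + k)%N (cylinder w) = #|follow X w k|%:R / N (size w + k).
  congr (_ / _); rewrite -card_blocks_prefix -sum1_card natr_sum.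
  rewrite /cnt big_mkcond [RHS]big_mkcond /=; apply: eq_bigr => u _.
  rewrite [in RHS]finset.in_set; case: (boolP (u \in _)) => //= /in_blocksP /ptP[_ uE].
  have tE : take (size w) u = word (pt u) 0 (size w).
    by rewrite -{1}uE size_tuple word_cat take_size_cat // size_word.
  have -> : `[< cylinder w (pt u) >] = (take (size w) u == w).
    by rewrite tE; apply/asboolP/eqP => /occurs_atP.
  by case: eqP.
have near P : (forall k, P (size w + k)%N) -> \forall n \near \oo, P n.
  by move=> h; exists (size w) => // n /= wn; rewrite -(subnKC wn).
split.
  (* Lower bound: there are at least [B * N k] followers, and
     [N (size w + k) <= N (size w) * N k]. *)
  rewrite -ler_pdivrMr //; apply: m_ge; apply: near => k; rewrite nuE.
  rewrite ler_pdivlMr // mulrAC ler_pdivrMr //.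
  apply: (le_trans _ (ler_wpM2r (ltW _) (follow_ge k lw))) => //.
  by rewrite -mulrA [N k * _]mulrC ler_pM2l // card_blocks_submul.
(* Upper bound: there are at most [N k] followers, and
   [B * (N (size w) * N k) <= N (size w + k)]. *)
rewrite mulrCA -ler_pdivlMr ?mulr_gt0 //; apply: m_le; apply: near => k.
rewrite nuE ler_pdivrMr // mulrAC mul1r ler_pdivlMr ?mulr_gt0 //.
apply: (le_trans _ (card_blocks_supmul (size w) k)).
rewrite mulrC -mulrA ler_pM2l // ler_pM2l // ler_nat.
exact/subset_leq_card/follow_sub_blocks.
Qed.

Lemma balanced_gibbs :
  exists mu : probability (g_sigma_algebraType (@borel_config A a0)) R,
    gibbs_state X mu.
Proof.
have [m [m_ge0 mT m_add mX m_cyl]] := balanced_mean.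
have [mu [muX muE]] := coding_probability a0 sX X0 m_ge0 mT m_add mX.
(* One factor [B] comes from comparing [m] of the cylinder with [1 / N r], the other from comparing
   [N r] with [2^(r h)]. *)
exists mu; split=> //; exists (B * B), (B * B)^-1.
rewrite invr_gt0 mulr_gt0 //; split=> //; split=> // w lw.
rewrite [mu _]muE -EFinM !lee_fin -/(cylinder w).
have [lo hi] := m_cyl w lw; have [e1 e2] := balanced_entropy (size w).
split.
  apply: (@le_trans _ _ (m (cylinder w) * (B * N (size w)))).
    by rewrite mulrCA ler_pM2l.
  by rewrite ler_wpM2l.
rewrite -[leRHS]mul1r ler_pdivlMr ?mulr_gt0 //; apply: le_trans hi.
rewrite mulrACA [_ * B]mulrC -mulrA ler_pM2l // ler_wpM2l //.
by rewrite mulrC.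
Qed.

End BalancedGibbs.

Theorem theorem3p14 (R : realType) (A : finType) (a0 : A) (X : set (int -> A)) :
  shift_space X -> X !=set0 ->
  ((exists mu : probability (g_sigma_algebraType (@borel_config A a0)) R,
       gibbs_state X mu) <->
   balanced (R := R) X).
Proof.
move=> sX X0; split=> [[mu gmu]|[B [B_gt0 B_le]]].
  exact: gibbs_balanced sX _ X0 gmu.
exact: (balanced_gibbs a0 sX X0 B_gt0 B_le).
Qed.
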